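(* Let $q$ be a prime power and let $1 \leq k < n$ be integers. If the statement $B(n,k)$ holds with constant $D_{n,k} \geq 0$, then the statement $A(n,k)$ holds with constant $$C_{n,k} = q^{-\frac{n}{k} D_{n,k}}.$$
   Context: $\mathbb{F}_q$ is the finite field with $q$ elements ($q$ is fixed), and linear means $\mathbb{F}_q$-linear. For integers $1 \leq k < n$ and $m \geq 1$, a subset $S \subseteq \mathbb{F}_q^n$ is $(k,m)$-Furstenberg if for each $k$-dimensional linear subspace $W$ of $\mathbb{F}_q^n$ there is a translate of $W$ that intersects $S$ in at least $m$ points. For a random variable $R$ taking values in $\mathbb{F}_q^N$, its $q$-ary min-entropy is $\mathbf{H}^q_\infty(R) = -\log_q\left(\max_{w \in \mathbb{F}_q^N} \Pr[R = w]\right)$. Statement $A(n,k)$ holds with constant $C_{n,k}$ if: for every $m$ and every $S \subseteq \mathbb{F}_q^n$ that is $(k,m)$-Furstenberg, $|S| \geq C_{n,k} \cdot m^{n/k}$. Statement $B(n,k)$ holds with constant $D_{n,k}$ if: for all $\delta \in [0,1]$, if $S \subseteq \mathbb{F}_q^n$ has size $|S| = q^{\delta n}$, then there exists an onto linear map $\varphi : \mathbb{F}_q^n \to \mathbb{F}_q^{n-k}$ such that $\mathbf{H}^q_\infty(\varphi(U_S)) \geq \delta(n-k) - D_{n,k}$, where $U_S$ is a random variable distributed uniformly over $S$. *)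

(* Defs.v *)
From mathcomp Require Import all_boot all_order all_algebra.
From mathcomp Require Import reals exp.

Set Implicit Arguments.
Unset Strict Implicit.
Unset Printing Implicit Defensive.

Import Order.TTheory GRing.Theory Num.Theory.
Local Open Scope ring_scope.

Definition furstenberg (F : finFieldType) (n k m : nat)
    (S : {set 'rV[F]_n}) : Prop :=
  forall W : {vspace 'rV[F]_n}, \dim W = k ->
    exists a : 'rV[F]_n,
      (m <= #|S :&: [set (a + w : 'rV[F]_n)%R | w : 'rV[F]_n in W]|)%N.

Definition logq (R : realType) (q : nat) (x : R) : R := ln x / ln q%:R.

(* A random variable is a map X : Omega -> T on a finite sample space Omega
   carrying a probability mass function P. *)
Definition Pr (R : realType) (Omega : finType) (P : Omega -> R)
    (A : {set Omega}) : R :=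
  \sum_(o in A) P o.

(* Probabilities are nonnegative, so the initial value 0 does not affect the
   maximum. *)
Definition min_entropy (R : realType) (q : nat) (Omega T : finType)
    (P : Omega -> R) (X : Omega -> T) : R :=
  - logq q (\big[Num.max/0]_(w : T) Pr P [set o | X o == w]).

Definition uniform (R : realType) (T : finType) (S : {set T}) (x : T) : R :=
  if x \in S then #|S|%:R^-1 else 0.

Lemma uniform_ge0 (R : realType) (T : finType) (S : {set T}) (x : T) :
  0 <= uniform R S x.
Proof. by rewrite /uniform; case: ifP => // _; rewrite invr_ge0 ler0n. Qed.

Lemma uniform_sum1 (R : realType) (T : finType) (S : {set T}) :
  S != set0 -> Pr (uniform R S) [set: T] = 1.
Proof.
move=> S0; rewrite /Pr /uniform (eq_bigl xpredT); last by move=> x; rewrite inE.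
rewrite -big_mkcond /= sumr_const -[_ *+ _]mulr_natl mulfV //.
by rewrite pnatr_eq0 cards_eq0.
Qed.

Definition statementA (R : realType) (F : finFieldType) (n k : nat) (C : R) :
    Prop :=
  forall (m : nat) (S : {set 'rV[F]_n}), (1 <= m)%N -> furstenberg k m S ->
    C * (m%:R `^ (n%:R / k%:R)) <= #|S|%:R.

(* U_S is the identity random variable on 'rV[F]_n under the law uniform S, so
   phi(U_S) is phi itself under that law. *)
Definition statementB (R : realType) (F : finFieldType) (n k : nat) (D : R) :
    Prop :=
  forall (delta : R) (S : {set 'rV[F]_n}), 0 <= delta <= 1 ->
    #|S|%:R = #|F|%:R `^ (delta * n%:R) ->
    exists phi : {linear 'rV[F]_n -> 'rV[F]_(n - k)},
      (forall y, exists x, phi x = y) /\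
      delta * (n - k)%:R - D <=
        min_entropy #|F| (uniform R S) (phi : 'rV[F]_n -> 'rV[F]_(n - k)).

(* Main.v *)
Require Import Defs.
From mathcomp Require Import all_boot all_order all_algebra.
From mathcomp Require Import reals exp.
From mathcomp Require Import ring lra.

(** Apply statement B to [S] itself, with [delta = log_q |S| / n].  It yields an
    onto linear map [phi] whose kernel [W] has dimension [k], so some translate
    [a + W] contains at least [m] points of [S].  Since [phi] is constant on
    that translate, [phi(U_S)] takes the value [phi a] with probability at
    least [m / |S|] ([fiber_Pr_ge]), hence its min-entropy is at most
    [log_q (|S| / m)] ([min_entropy_le]).  Comparing with the lower bound
    [delta (n - k) - D] gives [log_q m <= delta k + D], which becomes the claimed
    inequality after multiplying by [n / k] and exponentiating. *)

Import Order.TTheory GRing.Theory Num.Theory.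
Local Open Scope ring_scope.

Lemma Pr_uniform (R : realType) (T : finType) (S A : {set T}) :
  Pr (uniform R S) A = #|S :&: A|%:R / #|S|%:R.
Proof.
rewrite /Pr /uniform -big_mkcondr /= (eq_bigl (mem (S :&: A))).
  by rewrite sumr_const -[_ *+ _]mulr_natl.
by move=> x; rewrite !inE andbC.
Qed.

(** An atom of probability at least [p] bounds the min-entropy by
    [- log_q p]. *)
Lemma min_entropy_le {R : realType} {q : nat} {Omega T : finType}
    {P : Omega -> R} {X : Omega -> T} {w : T} {p : R} :
  (1 < q)%N -> 0 < p -> p <= Pr P [set o | X o == w] ->
  min_entropy q P X <= - logq q p.
Proof.
move=> q1 p0 ple; rewrite /min_entropy lerN2 /logq.
rewrite ler_pM2r ?invr_gt0 ?ln_gt0 ?ltr1n //.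
have pM : p <= \big[Num.max/0]_(v : T) Pr P [set o | X o == v].
  exact: le_trans ple (le_bigmax _ (fun v => Pr P [set o | X o == v]) w).
by rewrite ler_ln ?posrE // (lt_le_trans p0).
Qed.

Lemma onto_lker_dim {F : finFieldType} {n k : nat}
    {phi : {linear 'rV[F]_n -> 'rV[F]_(n - k)}} :
  (k <= n)%N -> (forall y, exists x, phi x = y) ->
  \dim (lker (linfun phi)) = k.
Proof.
move=> kn onto.
have := limg_ker_dim (linfun phi) fullv.
have -> : (linfun phi @: fullv)%VS = fullv.
  apply/vspaceP => y; rewrite memvf; have [x <-] := onto y.
  by rewrite -(lfunE phi) memv_img ?memvf.
rewrite capfv !dimvf /dim /= !mul1n => e; apply/eqP.
by rewrite -(eqn_add2r (n - k)) e subnKC.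
Qed.

Lemma furstenberg_card_ge {F : finFieldType} {n k m : nat}
    {S : {set 'rV[F]_n}} {W : {vspace 'rV[F]_n}} :
  \dim W = k -> furstenberg k m S -> (m <= #|S|)%N.
Proof.
move=> dW /(_ W dW) [a]; move/leq_trans; apply.
by rewrite subset_leq_card // subsetIl.
Qed.

Lemma fiber_Pr_ge (R : realType) {F : finFieldType} {n p m : nat}
    {S : {set 'rV[F]_n}} {phi : {linear 'rV[F]_n -> 'rV[F]_p}} {a : 'rV[F]_n} :
  (m <= #|S :&: [set (a + w)%R | w : 'rV[F]_n in lker (linfun phi)]|)%N ->
  m%:R / #|S|%:R <= Pr (uniform R S) [set x | phi x == phi a].
Proof.
move=> mle; rewrite Pr_uniform ler_wpM2r ?invr_ge0 ?ler0n // ler_nat.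
apply: leq_trans mle _; apply/subset_leq_card/setIS/subsetP => _ /imsetP[w + ->].
by rewrite memv_ker inE lfunE /= raddfD /= => /eqP ->; rewrite addr0.
Qed.

Theorem lemma15 (R : realType) (F : finFieldType) (n k : nat) (D : R)
    (hk : (1 <= k)%N) (hkn : (k < n)%N) (hD : 0 <= D) :
  statementB F n k D ->
  statementA F n k (#|F|%:R `^ (- (n%:R / k%:R * D))).
Proof.
move=> hB m S m1 hS.
have q1 : (1 < #|F|)%N by exact: card_finNzRing_gt1.
have q0 : 0 < #|F|%:R :> R by rewrite ltr0n ltnW.
have L0 : 0 < ln #|F|%:R :> R by rewrite ln_gt0 ?ltr1n.
have k0 : 0 < k%:R :> R by rewrite ltr0n.
have n0 : 0 < n%:R :> R by rewrite ltr0n (leq_trans hk) // ltnW.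
have m0 : 0 < m%:R :> R by rewrite ltr0n.
have s1 : (0 < #|S|)%N.
  (* The span of [k] vectors of a basis is a subspace of dimension [k], so the
     Furstenberg property is not vacuous. *)
  pose U := << take k (vbasis (fullv : {vspace 'rV[F]_n})) >>%VS.
  have dU : \dim U = k.
    have fr : free (take k (vbasis (fullv : {vspace 'rV[F]_n}))).
      apply: (@catl_free _ _ (drop k (vbasis (fullv : {vspace 'rV[F]_n})))).
      by rewrite cat_take_drop (basis_free (vbasisP _)).
    rewrite (eqnP fr) size_takel // size_tuple dimvf /dim /= mul1n ltnW //.
  exact: leq_trans m1 (furstenberg_card_ge dU hS).
have s0 : 0 < #|S|%:R :> R by rewrite ltr0n.
pose delta : R := ln #|S|%:R / (n%:R * ln #|F|%:R).
have dE : delta * n%:R * ln #|F|%:R = ln #|S|%:R.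
  by rewrite /delta; field; rewrite !gt_eqF.
have d01 : 0 <= delta <= 1.
  rewrite divr_ge0 ?ln_ge0 ?ler1n ?mulr_ge0 ?(ltW n0) ?(ltW L0) //=.
  rewrite ler_pdivrMr ?mulr_gt0 // mul1r mulr_natl -lnXn //.
  rewrite ler_ln ?posrE ?exprn_gt0 // -natrX ler_nat.
  by rewrite (leq_trans (max_card _)) // card_mx mul1n.
have cS : #|S|%:R = #|F|%:R `^ (delta * n%:R) :> R.
  by rewrite /powR gt_eqF // dE lnK.
have [phi [onto hphi]] := hB delta S d01 cS.
have [a /(fiber_Pr_ge R) pa] :=
  hS _ (onto_lker_dim (ltnW hkn) onto).
have := le_trans hphi (min_entropy_le q1 (divr_gt0 m0 s0) pa).
rewrite /logq ln_div ?posrE // -mulNr ler_pdivlMr // natrB ?(ltnW hkn) // => hlog.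
rewrite /powR !gt_eqF // -expRD -[leRHS]lnK ?posrE // ler_expR.
have -> : - (n%:R / k%:R * D) * ln #|F|%:R + n%:R / k%:R * ln m%:R
  = n%:R / k%:R * (ln m%:R - D * ln #|F|%:R) :> R by ring.
have -> : ln #|S|%:R = n%:R / k%:R * (delta * k%:R * ln #|F|%:R) :> R.
  by rewrite -dE; field; rewrite gt_eqF.
rewrite ler_pM2l ?divr_gt0 //.
by move: hlog; rewrite -dE; lra.
Qed.
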